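(* Let $n\ge 4$ and let $\Gamma$ be a connected simple graph of order $n$ with exactly one bridge. Then \[ SO(\Gamma)\ge 2(n-3)\sqrt{2}+\sqrt{10}+2\sqrt{13}, \] with equality if and only if $\Gamma\cong \mathbb{P}_n^1$.
   Context: The Sombor index of a graph $\Gamma$ is $SO(\Gamma)=\sum_{uv\in E(\Gamma)}\sqrt{\deg_\Gamma(u)^2+\deg_\Gamma(v)^2}$. A bridge is an edge whose deletion disconnects the graph. $\mathbb{P}_n^1$ is the graph obtained from the cycle $C_{n-1}$ by adding one new vertex adjacent to exactly one vertex of the cycle. *)

(* Defs.v *)
From HB Require Import structures.
From mathcomp Require Import all_boot all_order all_algebra.

Set Implicit Arguments.
Unset Strict Implicit.
Unset Printing Implicit Defensive.

Import Order.TTheory GRing.Theory Num.Theory.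

Record sgraph (V : finType) := SGraph {
  adj :> rel V;
  adj_sym : symmetric adj;
  adj_irrefl : irreflexive adj }.

Section Graphs.

Variable V : finType.
Implicit Types (G : sgraph V) (A : {set V}).

(* Edges are the two-element sets of adjacent vertices. *)
Definition edges G : {set {set V}} :=
  [set A | [exists x, exists y, G x y && (A == [set x; y])]].

Definition deg G (x : V) : nat := #|[set y | G x y]|.

Definition connected G : bool := [forall x, forall y, connect G x y].

Definition del_edge_rel G A : rel V :=
  fun x y => G x y && ([set x; y] != A).

Lemma del_edge_sym G A : symmetric (del_edge_rel G A).
Proof. by move=> x y; rewrite /del_edge_rel adj_sym setUC. Qed.

Lemma del_edge_irrefl G A : irreflexive (del_edge_rel G A).
Proof. by move=> x; rewrite /del_edge_rel adj_irrefl. Qed.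

Definition del_edge G A : sgraph V :=
  SGraph (del_edge_sym G A) (del_edge_irrefl G A).

(* Meant for connected G. *)
Definition bridge G A : bool :=
  (A \in edges G) && ~~ connected (del_edge G A).

Definition bridges G : {set {set V}} := [set A | bridge G A].

(* An edge uv is the set A = [set u; v], so the inner sum is
   deg u ^ 2 + deg v ^ 2; see edge_weightE. *)
Definition sombor (R : rcfType) G : R :=
  (\sum_(A in edges G) Num.sqrt (\sum_(x in A) (deg G x)%:R ^+ 2))%R.

Lemma edge_weightE (R : rcfType) G u v : G u v ->
  (\sum_(x in [set u; v]) (deg G x)%:R ^+ 2
   = (deg G u)%:R ^+ 2 + (deg G v)%:R ^+ 2 :> R)%R.
Proof.
move=> Guv; rewrite big_setU1 ?big_set1 // inE.
by apply: contraTneq Guv => ->; rewrite adj_irrefl.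
Qed.

Definition add_pendant_rel G (v : V) : rel (option V) := fun x y =>
  match x, y with
  | Some a, Some b => G a b
  | Some a, None => a == v
  | None, Some b => b == v
  | None, None => false
  end.

Lemma add_pendant_sym G v : symmetric (add_pendant_rel G v).
Proof. by move=> [a|] [b|] //=; rewrite adj_sym. Qed.

Lemma add_pendant_irrefl G v : irreflexive (add_pendant_rel G v).
Proof. by move=> [a|] //=; rewrite adj_irrefl. Qed.

Definition add_pendant G v : sgraph (option V) :=
  SGraph (add_pendant_sym G v) (add_pendant_irrefl G v).

End Graphs.

Arguments sombor {V} R G.

Definition graph_iso (V W : finType) (G : sgraph V) (H : sgraph W) : Prop :=
  exists2 f : V -> W, bijective f & forall x y, H (f x) (f y) = G x y.

Definition cycle_rel (m : nat) : rel 'I_m := fun i j =>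
  (i != j) && ((j == i.+1 %[mod m]) || (i == j.+1 %[mod m])).

Lemma cycle_sym m : symmetric (@cycle_rel m).
Proof. by move=> i j; rewrite /cycle_rel eq_sym orbC. Qed.

Lemma cycle_irrefl m : irreflexive (@cycle_rel m).
Proof. by move=> i; rewrite /cycle_rel eqxx. Qed.

(* The cycle C_m when m >= 3. *)
Definition cycle_graph m : sgraph 'I_m :=
  SGraph (@cycle_sym m) (@cycle_irrefl m).

(* P_n^1; here n.-2.+1 = n - 1 for n >= 2, a form for which ord0 exists. *)
Definition P1 (n : nat) : sgraph (option 'I_n.-2.+1) :=
  add_pendant (cycle_graph n.-2.+1) ord0.

(* Main.v *)
(* The ends u, v of the unique bridge can be ordered so that deg v >= 3 and
   deg u is 1 or at least 3: an end of degree 2 would make its other edge a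
   bridge too, and two ends of degree 1 leave no other vertex.  Every other
   vertex has degree at least 2, since the edge at a vertex of degree 1 is a
   bridge.  Hence there are at least n edges by the handshake lemma.  Every edge
   weighs at least sqrt 8, the bridge at least sqrt 10, and two further edges at
   v at least sqrt 13, so the Sombor index exceeds the bound by at least
   (|E| - n) sqrt 8.  Thus equality means |E| = n, which forces deg u = 1,
   deg v = 3 and degree 2 elsewhere.  A non-bridge edge at v then lies on a
   simple cycle; the degrees leave room for no edge off this cycle but uv, so by
   connectedness it covers everything but u. *)

Require Import Defs.
From HB Require Import structures.
From mathcomp Require Import all_boot all_order all_algebra.
From mathcomp Require Import zify ring lra.

Set Implicit Arguments.
Unset Strict Implicit.
Unset Printing Implicit Defensive.

Import Order.TTheory GRing.Theory Num.Theory.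

(** * Edges as two-element sets, and the handshake lemma *)

Section Edges.

Variables (V : finType) (G : sgraph V).
Implicit Types (x y z : V) (A : {set V}).

Lemma adj_neq x y : G x y -> x != y.
Proof. by apply: contraTneq => ->; rewrite adj_irrefl. Qed.

Lemma edgesP A :
  reflect (exists x y, G x y /\ A = [set x; y]) (A \in edges G).
Proof.
rewrite inE; apply: (iffP existsP) => [[x /existsP[y /andP[Gxy /eqP->]]]|].
  by exists x, y.
by case=> x [y [Gxy ->]]; exists x; apply/existsP; exists y; rewrite Gxy eqxx.
Qed.

Lemma mem_edges x y : G x y -> [set x; y] \in edges G.
Proof. by move=> Gxy; apply/edgesP; exists x, y. Qed.

Lemma set2_injr x y z : [set x; y] = [set x; z] -> y = z.
Proof.
move=> E; have: y \in [set x; z] by rewrite -E set22.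
have: z \in [set x; y] by rewrite E set22.
by rewrite !inE => /orP[] /eqP-> // /orP[] /eqP.
Qed.

Lemma edges_at x : [set A in edges G | x \in A] = [set [set x; y] | y in [set y | G x y]].
Proof.
apply/setP=> A; apply/setIdP/imsetP => [[/edgesP[a [b [Gab ->]]]]|[y]].
  rewrite !inE => /orP[] /eqP->; first by exists b; rewrite ?inE.
  by exists a; rewrite ?inE 1?adj_sym // setUC.
by rewrite inE => Gxy ->; rewrite set21 mem_edges.
Qed.

Lemma card_edges_at x : #|[set A in edges G | x \in A]| = deg G x.
Proof. by rewrite edges_at card_imset // => y z; apply: set2_injr. Qed.

(** Double counting of incident pairs of a vertex and an edge: each edge has exactly two ends. *)
Lemma sum_deg : \sum_x deg G x = (2 * #|edges G|)%N.
Proof.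
under eq_bigr => x _ do rewrite -card_edges_at -sum1_card.
under eq_bigr => x _ do under eq_bigl => A do rewrite inE.
rewrite (exchange_big_dep [in edges G]) /=; last by move=> ? ? _ /andP[].
rewrite mulnC -sum_nat_const; apply: eq_bigr => A AE.
under eq_bigl => x do rewrite AE /=.
rewrite sum1_card; case/edgesP: AE => x [y [Gxy ->]].
by rewrite cards2 (adj_neq Gxy).
Qed.

End Edges.

(** * Bridges of a connected graph and the degrees at their ends *)

Section Bridges.

Variables (V : finType) (G : sgraph V).
Hypothesis G_conn : connected G.
Implicit Types (x y z : V) (A : {set V}).

Lemma connectG x y : connect G x y.
Proof. by move/forallP: G_conn => /(_ x)/forallP. Qed.

Lemma connected_closed (S : {set V}) x :
  x \in S -> (forall y z, G y z -> y \in S -> z \in S) -> S = setT.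
Proof.
move=> xS clS; apply/setP=> y; rewrite inE.
have cl : closed G [in S].
  by apply: intro_closed => [|a b]; [apply/sym_connect_sym/adj_sym | apply: clS].
by rewrite -(closed_connect cl (connectG x y)).
Qed.

(** If [x] and [y] stay joined after the deletion, every use of the edge [xy] in a path can be
    replaced by that detour. *)
Lemma bridgeE x y : G x y ->
  bridge G [set x; y] = ~~ connect (del_edge G [set x; y]) x y.
Proof.
move=> Gxy; rewrite /bridge mem_edges //=; congr (~~ _).
apply/idP/idP => [/forallP/(_ x)/forallP //|cxy].
apply/forallP=> a; apply/forallP=> b.
apply: (connect_sub _ (connectG a b)) => {a b} a b Gab.
have [/= E|ne] := eqVneq [set a; b] [set x; y]; last first.
  by apply: connect1; rewrite /= /del_edge_rel Gab.
have csym : connect_sym (del_edge G [set x; y]).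
  apply/sym_connect_sym/adj_sym.
have : a \in [set x; y] by rewrite -E set21.
rewrite !inE => /orP[] /eqP Ea; rewrite Ea in E *.
  by rewrite (set2_injr E).
by move: E; rewrite [RHS]setUC => /set2_injr ->; rewrite csym.
Qed.

(** Without the edge [xy], the set [S] is closed under adjacency, so no path leads from [x] out to
    [y]. *)
Lemma cut_bridge (S : {set V}) x y : G x y -> x \in S -> y \notin S ->
    (forall a b, G a b -> a \in S -> b \notin S -> [set a; b] = [set x; y]) ->
  bridge G [set x; y].
Proof.
move=> Gxy xS yS cut; rewrite bridgeE //; apply: contraNN yS => cxy.
have cl : closed (del_edge G [set x; y]) [in S].
  apply: intro_closed => [|a b /andP[Gab ne] aS]; first apply/sym_connect_sym/adj_sym.
  by apply: contraNT ne => bS; apply/eqP/cut.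
by rewrite -(closed_connect cl cxy).
Qed.

Lemma deg_gt0 x : (1 < #|V|)%N -> (0 < deg G x)%N.
Proof.
move=> V1; rewrite lt0n cards_eq0; apply: contraTneq V1 => N0.
rewrite -cardsT -(@connected_closed [set x] x) ?cards1 ?set11 // => y z Gyz.
rewrite !inE => /eqP Ey; have : z \in [set y | G x y] by rewrite inE -Ey.
by rewrite N0 inE.
Qed.

Lemma deg1_adj x y z : deg G x = 1%N -> G x y -> G x z -> y = z.
Proof.
move/eqP/cards1P=> [w Nx] Gy Gz.
have Nw a : G x a -> a = w by move=> Ga; apply/set1P; rewrite -Nx inE.
by rewrite (Nw y) // (Nw z).
Qed.

Lemma deg1_bridge x y : deg G x = 1%N -> G x y -> bridge G [set x; y].
Proof.
move=> dx Gxy; apply: (@cut_bridge [set x]); rewrite ?set11 //.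
  by rewrite inE eq_sym (adj_neq Gxy).
by move=> a b Gab /set1P Ea _; rewrite Ea in Gab *; rewrite (deg1_adj dx Gab Gxy).
Qed.

Lemma deg2_bridge u v : G u v -> bridge G [set u; v] -> deg G u = 2%N ->
  exists w, [/\ w != v, G u w & bridge G [set u; w]].
Proof.
move=> Guv buv du; have : #|[set y | G u y] :\ v| = 1%N.
  by move: du; rewrite /deg (cardsD1 v) inE Guv => -[].
move=> /eqP/cards1P[w Nu].
have : w \in [set w] by rewrite set11.
rewrite -Nu !inE => /andP[wv Guw]; exists w; split=> //.
have Nw a : G u a -> a != v -> a = w.
  by move=> Ga av; apply/set1P; rewrite -Nu !inE av.
rewrite setUC; pose D := del_edge G [set u; v].
have csym : connect_sym D by apply/sym_connect_sym/adj_sym.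
(* S is the side of u in G - uv, with u removed; wu is the only edge leaving S. *)
pose S := [set x | connect D u x] :\ u.
have vS : v \notin [set x | connect D u x] by rewrite inE -bridgeE.
have SD a b : G a b -> a \in S -> b != u -> b \in S.
  rewrite !inE => Gab /andP[au ca] bu; rewrite bu /=.
  have [E|ne] := eqVneq [set a; b] [set u; v].
    have : u \in [set a; b] by rewrite E set21.
    by rewrite !inE eq_sym (negPf au) eq_sym (negPf bu).
  by apply: connect_trans ca (connect1 _); rewrite /= /del_edge_rel Gab.
apply: (@cut_bridge S).
- by rewrite adj_sym.
- rewrite !inE eq_sym (adj_neq Guw) connect1 //= /del_edge_rel Guw.
  by apply: contraNneq wv => /set2_injr ->.
- by rewrite !inE eqxx.
move=> a b Gab aS bS; have bu : b = u.
  by apply/eqP; apply: contraNT bS; apply: SD Gab aS.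
(* The end [a] in [S] is a neighbour of [u], and it is not [v], which the bridge cuts off from [u];
   only [w] remains. *)
rewrite bu in Gab *; rewrite (Nw a) 1?adj_sym //.
by apply: contraNneq vS => <-; case/setD1P: aS.
Qed.

Lemma one_bridge_degrees : (2 < #|V|)%N -> #|bridges G| = 1%N ->
  exists u v, [/\ G u v, bridges G = [set [set u; v]], (2 < deg G v)%N,
    deg G u = 1%N \/ (2 < deg G u)%N &
    forall x, x != u -> x != v -> (1 < deg G x)%N].
Proof.
move=> V2 /eqP/cards1P[A BA].
have bA : bridge G A by have := set11 A; rewrite -BA inE.
have bE B : bridge G B -> B = A by move=> bB; apply/set1P; rewrite -BA inE.
case/andP: (bA) => /edgesP[u [v [Guv EA]]] _; subst A.
(* With the ends ordered by degree, [deg G v = 1] forces [deg G u = 1], and then [[set u; v]] is a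
   whole component. *)
wlog uv : u v Guv BA bA bE / (deg G u <= deg G v)%N.
  by case/orP: (leq_total (deg G u) (deg G v)) => le W; [apply: (W u v)|
    apply: (W v u) => //; rewrite 1?adj_sym // 1?setUC].
have V1 := ltnW V2.
have ne2 a b : G a b -> bridge G [set a; b] -> 
  (forall B, bridge G B -> B = [set a; b]) -> deg G a <> 2%N.
  move=> Gab bab bEab da; have [w [wb _ /bEab/set2_injr E]] := deg2_bridge Gab bab da.
  by rewrite E eqxx in wb.
have du2 : deg G u <> 2%N by apply: (ne2 u v).
have dv2 : deg G v <> 2%N.
  by apply: (ne2 v u); rewrite 1?adj_sym // setUC.
have du0 := deg_gt0 u V1.
exists u, v; split=> //; last 2 first.
- by case: (deg G u) du0 du2 => [|[|[|k]]] // _ _; [left|right].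
- move=> x xu xv; have dx0 := deg_gt0 x V1.
  rewrite ltn_neqAle dx0 andbT eq_sym; apply/eqP=> dx.
  have /card_gt0P[y] := dx0; rewrite inE => Gxy.
  have := bE _ (deg1_bridge dx Gxy) => E.
  have : x \in [set u; v] by rewrite -E set21.
  by rewrite !inE (negPf xu) (negPf xv).
have dv0 := deg_gt0 v V1.
suff dv1 : deg G v <> 1%N by case: (deg G v) dv0 dv1 dv2 => [|[|[|k]]].
move=> dv; have du : deg G u = 1%N by apply/eqP; rewrite eqn_leq du0 -dv uv.
suff E : [set u; v] = setT.
  by move: V2; rewrite -cardsT -E cards2; case: (_ != _).
apply: (connected_closed (set21 u v)) => y z Gyz.
have Gvu : G v u by rewrite adj_sym.
rewrite !inE => /orP[] /eqP Ey; rewrite Ey in Gyz.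
  by rewrite (deg1_adj du Gyz Guv) eqxx orbT.
by rewrite (deg1_adj dv Gyz Gvu) eqxx.
Qed.

End Bridges.

(** * Successor and predecessor along a cyclic sequence *)

Lemma modS_small m i : i < m -> i.+1 %% m = if i.+1 == m then 0 else i.+1.
Proof.
move=> im; case: eqP => [->|/eqP ne]; first by rewrite modnn.
by rewrite modn_small // ltn_neqAle ne.
Qed.

Section NextPrev.

Variables (T : eqType) (s : seq T).
Hypothesis s_uniq : uniq s.

Lemma next_nth_mod x0 i : i < size s ->
  next s (nth x0 s i) = nth x0 s (i.+1 %% size s).
Proof.
move=> im; rewrite next_nth mem_nth // index_uniq // modS_small //.
(* [next_nth] reads position [i] of the tail with the head as default value; at the last index this
   default is the wrap-around to position 0. *)
case: s im => //= y p im; case: eqP => [[->]|ne]; first by rewrite nth_default.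
apply: set_nth_default; rewrite ltn_neqAle -ltnS im andbT.
by apply/eqP=> E; apply: ne; rewrite E.
Qed.

(** Otherwise two successor steps would return to [x], that is, a shift by 2 would be trivial modulo
    [size s]. *)
Lemma next_neq_prev x : 2 < size s -> x \in s -> next s x != prev s x.
Proof.
move=> s2 xs; apply/eqP=> /(congr1 (next s)); rewrite next_prev //.
have ix : index x s < size s by rewrite index_mem.
have jx : (index x s).+1 %% size s < size s by rewrite ltn_mod (leq_trans _ ix).
rewrite -[in LHS](nth_index x xs) !next_nth_mod // -[RHS](nth_index x xs) => /eqP.
rewrite nth_uniq ?ltn_mod ?(leq_trans _ ix) // (modS_small jx) (modS_small ix).
by move: s2 ix; repeat case: ifP; lia.
Qed.

End NextPrev.

(** * Structure of the graph in the equality case *)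

Section Lollipop.

Variables (V : finType) (G : sgraph V) (u v : V).
Hypotheses (G_conn : connected G) (Guv : G u v).
Hypotheses (du : deg G u = 1) (dv : deg G v = 3).
Hypothesis dx : forall x, x != u -> x != v -> deg G x = 2.

Let Gvu : G v u. Proof. by rewrite adj_sym. Qed.

(** A simple path from [v] to [y] that avoids the edge [vy] is closed up by this edge. *)
Lemma nonbridge_cycle y : G v y -> ~~ bridge G [set v; y] ->
  exists s, [/\ uniq s, cycle G s, 2 < size s & v \in s].
Proof.
move=> Gvy; rewrite bridgeE // negbK => /connectP[p0 Pp0 Ey].
move: Ey; case/shortenP: Pp0 => p Pp p_uniq _ Ey.
exists (v :: p); split; rewrite ?mem_head //=.
  rewrite rcons_path -Ey adj_sym Gvy andbT.
  by apply: sub_path Pp => a b /andP[].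
(* An empty path would give [y = v], and a path of one step would use the deleted edge. *)
case: p Pp p_uniq Ey => [|a [|b p]] //=.
  by move=> _ _ E; rewrite E adj_irrefl in Gvy.
by rewrite andbT => Pa _ Ey; move: Pa; rewrite -Ey /del_edge_rel eqxx andbF.
Qed.

Variable s : seq V.
Hypotheses (s_uniq : uniq s) (s_cyc : cycle G s) (s2 : 2 < size s).
Hypothesis vs : v \in s.

Lemma adj_next x : x \in s -> G x (next s x).
Proof. exact: next_cycle. Qed.

Lemma adj_prev x : x \in s -> G x (prev s x).
Proof. by move=> xs; rewrite adj_sym prev_cycle. Qed.

Lemma u_notin_s : u \notin s.
Proof.
apply/negP=> us; have := next_neq_prev s_uniq s2 us.
by rewrite (deg1_adj du (adj_next us) (adj_prev us)) eqxx.
Qed.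

(** The listed vertices are distinct neighbours, and there are already as many of them as the degree
    allows. *)
Lemma cycle_nbhs x : x \in s ->
  [set y | G x y] = (if x == v then [set u] else set0) :|: [set next s x; prev s x].
Proof.
move=> xs; have xu : x != u by apply: contraNneq u_notin_s => <-.
apply/esym/eqP; rewrite eqEcard; apply/andP; split.
  apply/subsetP=> y; rewrite !inE => /orP[|/orP[]/eqP->]; rewrite ?adj_next ?adj_prev //.
  by case: eqP => [->|_]; rewrite inE // => /eqP->.
rewrite -[#|[set y | _]|]/(deg G x).
have c2 : #|[set next s x; prev s x]| = 2 by rewrite cards2 next_neq_prev.
case: (eqVneq x v) => [->|xv]; last by rewrite set0U c2 dx.
have uv' : u \notin [set next s v; prev s v].
  by rewrite !inE; apply: contraNN u_notin_s => /orP[] /eqP->; rewrite ?mem_next ?mem_prev.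
rewrite dv cardsU1 uv' cards2 next_neq_prev //.
Qed.

Lemma cycle_span : [set x in u :: s] = setT.
Proof.
apply: (connected_closed G_conn (x := u)) => [|y z]; first by rewrite inE mem_head.
rewrite !inE => Gyz /orP[/eqP Ey|ys].
  by rewrite Ey in Gyz; rewrite (deg1_adj du Gyz Guv) vs orbT.
have : z \in [set z | G y z] by rewrite inE.
rewrite cycle_nbhs // !inE => /orP[|/orP[]/eqP->]; last 2 first.
- by rewrite mem_next ys orbT.
- by rewrite mem_prev ys orbT.
by case: ifP => _; rewrite inE // => ->.
Qed.

Lemma card_cycle_span : #|V| = (size s).+1.
Proof.
by rewrite -cardsT -cycle_span cardsE; apply/card_uniqP; rewrite /= u_notin_s.
Qed.

End Lollipop.

(** * The isomorphism with [P1] *)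

Lemma graph_iso_inv (V W : finType) (G : sgraph V) (H : sgraph W) (g : W -> V) :
  bijective g -> (forall a b, G (g a) (g b) = H a b) -> graph_iso G H.
Proof.
case=> f gK fK gG; exists f; first by exists g.
by move=> x y; rewrite -gG !fK.
Qed.

(** The cycle is rotated to start at [v], so that position 0, where [P1] has its pendant vertex
    attached, corresponds to [v], and [None] to [u]. *)
Lemma lollipop_iso (V : finType) (G : sgraph V) (u v y : V) :
    connected G -> G u v -> deg G u = 1 -> deg G v = 3 ->
    (forall x, x != u -> x != v -> deg G x = 2) ->
    G v y -> ~~ bridge G [set v; y] ->
  graph_iso G (P1 #|V|).
Proof.
move=> G_conn Guv du dv dx Gvy nb.
have [s0 [s0_uniq s0_cyc s0_2 vs0]] := nonbridge_cycle G_conn Gvy nb.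
have [i s Es] := rot_to vs0.
have s_uniq : uniq (v :: s) by rewrite -Es rot_uniq.
have s_cyc : cycle G (v :: s) by rewrite -Es rot_cycle.
have s2 : 2 < size (v :: s) by rewrite -Es size_rot.
have vs := mem_head v s.
have cV := card_cycle_span G_conn Guv du dv dx s_uniq s_cyc s2 vs.
have nbh := cycle_nbhs Guv du dv dx s_uniq s_cyc s2.
have us := u_notin_s du s_uniq s_cyc s2.
rewrite cV.
set t := v :: s in s_uniq s_cyc s2 vs cV nbh us *.
(* Since [t] is a cons, [(size t).+1.-2.+1] computes to [size t]: these ordinals are exactly the
   positions in [t]. *)
have ltm (j : 'I_(size t).+1.-2.+1) : j < size t := ltn_ord j.
pose g (o : option 'I_(size t).+1.-2.+1) := if o is Some j then nth v t j else u.
have tj (j : 'I_(size t).+1.-2.+1) : nth v t j \in t by apply: mem_nth (ltm j).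
have tu (j : 'I_(size t).+1.-2.+1) : (nth v t j == u) = false.
  by apply: contraNF us => /eqP <-.
have tv (j : 'I_(size t).+1.-2.+1) : (nth v t j == v) = (j == ord0).
  by rewrite -[X in _ == X]/(nth v t 0) nth_uniq.
apply: (graph_iso_inv (g := g)).
  apply: inj_card_bij; last by rewrite cV card_option card_ord.
  move=> [a|] [b|] //= /eqP; rewrite ?[u == _]eq_sym ?tu //.
  by rewrite nth_uniq // => /eqP E; congr Some; apply: val_inj.
have Gu x : G u x = (x == v).
  by apply/idP/eqP => [Gux|-> //]; apply: deg1_adj du Gux Guv.
move=> [a|] [b|] /=; rewrite ?adj_irrefl ?Gu ?tv //; last first.
  by rewrite adj_sym Gu tv.
have -> : G (nth v t a) (nth v t b) = (nth v t b \in [set y | G (nth v t a) y]).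
  by rewrite inE.
have E : (next t (nth v t a) == nth v t b) = (b == a.+1 %[mod size t]).
  by rewrite next_nth_mod // nth_uniq ?ltn_mod // eq_sym [b %% _]modn_small.
have F : (next t (nth v t b) == nth v t a) = (a == b.+1 %[mod size t]).
  by rewrite next_nth_mod // nth_uniq ?ltn_mod // eq_sym [a %% _]modn_small.
rewrite nbh // !inE /cycle_rel -E -F.
have -> : (nth v t b == prev t (nth v t a)) = (next t (nth v t b) == nth v t a).
  by rewrite -(can_eq (prev_next s_uniq)) next_prev.
have -> : (nth v t b \in if nth v t a == v then [set u] else set0) = false.
  by case: ifP; rewrite inE ?tu.
(* On the diagonal [cycle_rel] fails by its conjunct [i != j]; the other side fails because a fixed
   point of [next] would be a loop. *)
rewrite orFb [_ == next _ _]eq_sym; have [->|//] := eqVneq a b.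
apply/negbTE; rewrite orbb; apply/negP=> /eqP E'.
by have := adj_next s_cyc (tj b); rewrite E' adj_irrefl.
Qed.

(** * Degree sums under isomorphism and in [P1] *)

Lemma graph_iso_sum_deg (V W : finType) (G : sgraph V) (H : sgraph W) :
  graph_iso G H -> \sum_x deg G x = \sum_y deg H y.
Proof.
case=> f fb fG; rewrite (reindex f) /=; last exact: onW_bij.
apply: eq_bigr => x _; rewrite /deg -(card_imset _ (bij_inj fb)).
apply: eq_card => y; case: (fb) => g gK fK; rewrite -(fK y) inE fG.
by rewrite mem_imset ?inE //; apply: bij_inj.
Qed.

Lemma deg_cycle_le m (i : 'I_m) : deg (cycle_graph m) i <= 2.
Proof.
have : [set j | cycle_graph m i j] \subset [set ordS i; ord_pred i].
  apply/subsetP=> j; rewrite !inE /= => /andP[_ /orP[]].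
    by rewrite modn_small // => /eqP E; apply/orP; left; apply/eqP/val_inj.
  rewrite modn_small // => /eqP E; apply/orP; right.
  by rewrite -(can_eq (@ordSK _)) ord_predK eq_sym; apply/eqP/val_inj.
by move/subset_leq_card/leq_trans; apply; rewrite cards2; case: (_ != _).
Qed.

Lemma deg_P1_le n (a : 'I_n.-2.+1) : deg (P1 n) (Some a) <= 2 + (a == ord0).
Proof.
rewrite /deg (cardsD1 None) inE addnC leq_add //.
have -> : [set y | P1 n (Some a) y] :\ None
    = Some @: [set b | cycle_graph n.-2.+1 a b].
  apply/setP=> [[b|]]; rewrite !inE.
    by rewrite mem_imset ?inE //; apply: Some_inj.
  by apply/idP/imsetP=> [|[]].
by rewrite card_imset ?deg_cycle_le //; apply: Some_inj.
Qed.

(** Via the handshake lemma this gives at most [n] edges; the upper bound suffices because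
    [card_edges_ge] supplies the reverse inequality. *)
Lemma sum_deg_P1_le n : 1 < n -> \sum_x deg (P1 n) x <= 2 * n.
Proof.
move=> n1; rewrite (bigD1 None) //= (reindex_omap Some id) => [|[] //] /=.
under eq_bigl => a do rewrite eqxx.
have -> : deg (P1 n) None = 1.
  rewrite /deg -(cards1 (Some (ord0 : 'I_n.-2.+1))).
  by apply: eq_card => -[a|]; rewrite !inE.
(* The pendant vertex counts 1, each of the [n - 1] cycle vertices 2, and the attachment vertex one
   more. *)
have -> : 2 * n = (1 + \sum_(a < n.-2.+1) (2 + (a == ord0))).
  by rewrite big_split sum_nat_const /= -big_mkcond /= big_pred1_eq card_ord; lia.
by rewrite leq_add2l leq_sum // => a _; apply: deg_P1_le.
Qed.

(** * Edge count and the Sombor estimate *)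

Section Extremal.

Variables (V : finType) (G : sgraph V) (u v : V).
Hypotheses (Guv : G u v) (dv : (2 < deg G v)%N).
Hypothesis du : deg G u = 1%N \/ (2 < deg G u)%N.
Hypothesis dx : forall x, x != u -> x != v -> (1 < deg G x)%N.

Lemma sum_degD :
  \sum_x deg G x = (deg G u + (deg G v + \sum_(x | (x != u) && (x != v)) deg G x))%N.
Proof. by rewrite (bigD1 u) //= (bigD1 v) //= eq_sym (adj_neq Guv). Qed.

(** Split like [sum_degD], so that degrees can be compared with 2 term by term; the 4 is the share
    of [u] and [v]. *)
Lemma cardVD : (2 * #|V| = 4 + \sum_(x : V | (x != u) && (x != v)) 2)%N.
Proof.
rewrite -sum1_card big_distrr /= (bigD1 u) //= (bigD1 v) //=.
by rewrite eq_sym (adj_neq Guv).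
Qed.

(** A degree 1 at [u] is made up for by [v], since 1 + 3 = 2 + 2. *)
Lemma card_edges_ge : (#|V| <= #|edges G|)%N.
Proof.
have := sum_deg G; rewrite sum_degD; have := cardVD.
have : (\sum_(x : V | (x != u) && (x != v)) 2
        <= \sum_(x | (x != u) && (x != v)) deg G x)%N.
  by apply: leq_sum => x /andP[xu xv]; apply: dx.
by case: du; lia.
Qed.

Lemma card_edges_eq : #|edges G| = #|V| ->
  [/\ deg G u = 1%N, deg G v = 3%N &
      forall x, x != u -> x != v -> deg G x = 2%N].
Proof.
move=> E; have := sum_deg G; rewrite sum_degD E; have := cardVD.
have le : forall x, (x != u) && (x != v) -> (2 <= deg G x)%N.
  by move=> x /andP[xu xv]; apply: dx.
have leS := leq_sum (index_enum V) le; move=> /= H1 H2.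
have du1 : deg G u = 1%N by case: du; lia.
have dv3 : deg G v = 3%N by lia.
split=> // x xu xv.
have D (F : V -> nat) : (\sum_(y | (y != u) && (y != v)) F y
    = F x + \sum_(y | (y != u) && (y != v) && (y != x)) F y)%N.
  by rewrite (bigD1 x) ?xu ?xv.
move: H1 H2; rewrite (D (deg G)) (D (fun=> 2)).
have : (\sum_(y | (y != u) && (y != v) && (y != x)) 2
        <= \sum_(y | (y != u) && (y != v) && (y != x)) deg G y)%N.
  by apply: leq_sum => y /andP[/le].
by have := dx xu xv; lia.
Qed.

Local Open Scope ring_scope.
Variable R : rcfType.

Definition weight (A : {set V}) : R := Num.sqrt (\sum_(x in A) (deg G x)%:R ^+ 2).

Lemma weightE x y : G x y -> 
  weight [set x; y] = Num.sqrt (deg G x ^ 2 + deg G y ^ 2)%N%:R.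
Proof. by move=> Gxy; rewrite /weight edge_weightE // natrD !natrX. Qed.

Lemma weight_ge x y k : G x y -> (k <= deg G x ^ 2 + deg G y ^ 2)%N ->
  Num.sqrt k%:R <= weight [set x; y].
Proof. by move=> Gxy kle; rewrite weightE // ler_wsqrtr // ler_nat. Qed.

Lemma deg_ge1 x y : G x y -> (0 < deg G x)%N.
Proof. by move=> Gxy; apply/card_gt0P; exists y; rewrite inE. Qed.

(** Here 8 is [2 ^ 2 + 2 ^ 2]. An edge with an end of degree 1 is [uv], whose other end has degree
    at least 3, and 1 + 9 exceeds 8. *)
Lemma edge_weight_ge A : A \in edges G -> Num.sqrt 8%:R <= weight A.
Proof.
move/edgesP=> [x [y [Gxy ->]]]; apply: weight_ge => //.
have Gx := deg_ge1 Gxy; have Gy : (0 < deg G y)%N by apply: (@deg_ge1 y x); rewrite adj_sym.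
have deg_le1 z : (deg G z <= 1)%N -> z = u /\ deg G u = 1%N.
  rewrite leqNgt => z1; have [zu|zu] := eqVneq z u; last first.
    have [zv|zv] := eqVneq z v; first by rewrite zv ltnW in z1.
    by rewrite dx in z1.
  by split=> //; case: du => // /ltnW; rewrite -zu (negPf z1).
have deg1 z w : G z w -> (deg G z <= 1)%N -> (2 < deg G w)%N.
  move=> Gzw /deg_le1[Ez d1]; rewrite Ez in Gzw.
  by rewrite (deg1_adj d1 Gzw Guv).
case: (leqP (deg G x) 1) => [/(deg1 _ _ Gxy)|]; first by nia.
case: (leqP (deg G y) 1) => [/(deg1 y x)|]; last by nia.
by rewrite adj_sym => /(_ Gxy); nia.
Qed.

(** Measuring weights from their minimum separates the number of edges from a sum of nonnegative
    terms. *)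
Lemma sombor_excess :
  sombor R G = #|edges G|%:R * Num.sqrt 8%:R
    + \sum_(A in edges G) (weight A - Num.sqrt 8%:R).
Proof.
by rewrite sumrB sumr_const mulr_natl addrC subrK.
Qed.

Lemma other_nbrs : exists y1 y2,
  [/\ y1 != y2, y1 != u, y2 != u, G v y1 & G v y2].
Proof.
have : (1 < #|[set y | G v y] :\ u|)%N.
  by move: dv; rewrite /deg (cardsD1 u) inE adj_sym Guv.
case/card_gt1P=> y1 [y2 []]; rewrite !inE => /andP[u1 G1] /andP[u2 G2] ne.
by exists y1, y2.
Qed.

Variables y1 y2 : V.
Hypotheses (y12 : y1 != y2) (y1u : y1 != u) (y2u : y2 != u).
Hypotheses (Gvy1 : G v y1) (Gvy2 : G v y2).

Let other (A : {set V}) :=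
  [&& A \in edges G, A != [set v; u], A != [set v; y1] & A != [set v; y2]].

Lemma excessD : \sum_(A in edges G) (weight A - Num.sqrt 8%:R) =
  (weight [set v; u] - Num.sqrt 8%:R) + (weight [set v; y1] - Num.sqrt 8%:R)
  + (weight [set v; y2] - Num.sqrt 8%:R)
  + \sum_(A | other A) (weight A - Num.sqrt 8%:R).
Proof.
have Gvu : G v u by rewrite adj_sym.
have y21 : y2 != y1 by rewrite eq_sym.
have ne a b : a != b -> [set v; a] != [set v; b].
  by apply: contraNneq => /set2_injr ->.
rewrite (bigD1 [set v; u]) ?mem_edges //= (bigD1 [set v; y1]) ?mem_edges ?ne //=.
rewrite (bigD1 [set v; y2]) ?mem_edges ?ne //= !addrA; congr (_ + _).
by apply: eq_bigl => A; rewrite /other -!andbA.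
Qed.

Lemma sqrt8 : Num.sqrt 8%:R = 2 * Num.sqrt 2 :> R.
Proof.
have -> : 8%:R = 2 ^+ 2 * 2 :> R by ring.
by rewrite sqrtrM ?sqrtr_sqr ?normr_nat // exprn_ge0.
Qed.

Let bound : R :=
  2 * (#|V|%:R - 3) * Num.sqrt 2 + Num.sqrt 10 + 2 * Num.sqrt 13.

(** This form reads edge by edge: [n - 3] edges of least weight, the bridge, and two further edges
    at [v]. *)
Lemma boundE :
  bound = (#|V|%:R - 3) * Num.sqrt 8%:R + Num.sqrt 10 + 2 * Num.sqrt 13.
Proof. by rewrite /bound sqrt8; ring. Qed.

(** The surplus in the number of edges is kept on the left, since it must vanish in the equality
    case. *)
Lemma sombor_bound :
  bound + (#|edges G|%:R - #|V|%:R) * Num.sqrt 8%:R <= sombor R G.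
Proof.
rewrite sombor_excess excessD.
have Gvu : G v u by rewrite adj_sym.
have dy y : G v y -> y != u -> (1 < deg G y)%N.
  move=> Gvy yu; apply: dx => //; rewrite eq_sym; exact: adj_neq Gvy.
(* The radicands are 10 = 1 + 9 for degrees 1 and 3, and 13 = 9 + 4 for degrees 3 and 2. *)
have w0 : Num.sqrt 10 <= weight [set v; u].
  by apply: weight_ge => //; have := deg_ge1 Guv; nia.
have w1 : Num.sqrt 13 <= weight [set v; y1].
  by apply: weight_ge => //; have := dy _ Gvy1 y1u; nia.
have w2 : Num.sqrt 13 <= weight [set v; y2].
  by apply: weight_ge => //; have := dy _ Gvy2 y2u; nia.
have w3 : 0 <= \sum_(A | other A) (weight A - Num.sqrt 8%:R).
  by apply: sumr_ge0 => A /and4P[AE _ _ _]; rewrite subr_ge0 edge_weight_ge.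
by rewrite boundE; lra.
Qed.

Lemma sombor_eq : #|edges G| = #|V| -> sombor R G = bound.
Proof.
move=> EV; have [du1 dv3 dx2] := card_edges_eq EV.
rewrite sombor_excess excessD EV.
have Gvu : G v u by rewrite adj_sym.
have yv y : G v y -> y != v by rewrite eq_sym; apply: adj_neq.
have -> : weight [set v; u] = Num.sqrt 10 by rewrite weightE // du1 dv3.
have -> : weight [set v; y1] = Num.sqrt 13 by rewrite weightE // dv3 dx2 ?yv.
have -> : weight [set v; y2] = Num.sqrt 13 by rewrite weightE // dv3 dx2 ?yv.
rewrite big1 => [|A]; first by rewrite boundE; ring.
(* As [v] has degree 3, its edges are exactly the three split off, so every remaining edge joins two
   vertices of degree 2 and has excess 0. *)
have Nv : [set y | G v y] = [set u; y1; y2].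
  apply/esym/eqP; rewrite eqEcard -[#|[set y | _]|]/(deg G v) dv3.
  rewrite -setUA !cardsU1 cards1 !inE ![u == _]eq_sym (negPf y1u) (negPf y2u) y12 andbT.
  by apply/subsetP=> y; rewrite !inE => /orP[|/orP[]] /eqP->.
case/and4P => /edgesP[x [y [Gxy ->]]].
have main a b : G a b -> [set a; b] != [set v; u] -> [set a; b] != [set v; y1] ->
    [set a; b] != [set v; y2] -> deg G a = 2%N.
  move=> Gab ne0 ne1 ne2; apply: dx2; last first.
    apply/eqP=> Ea; rewrite Ea in Gab ne0 ne1 ne2.
    have : b \in [set u; y1; y2] by rewrite -Nv inE.
    rewrite !inE => /orP[/orP[]|] /eqP Eb; rewrite Eb eqxx // in ne0 ne1 ne2.
  apply: contraNneq ne0 => Ea; rewrite Ea in Gab *.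
  by rewrite (deg1_adj du1 Gab Guv) setUC.
move=> ne0 ne1 ne2; rewrite weightE // (main x y) // (main y x) ?subrr //.
- by rewrite adj_sym.
all: by rewrite setUC.
Qed.

End Extremal.

(** * The inequality and its equality case *)

Local Open Scope ring_scope.

Theorem theorem4p2 (R : rcfType) (n : nat) (V : finType) (G : sgraph V)
    (hn : (4 <= n)%N) (hV : #|V| = n) (hconn : connected G)
    (hbridge : #|bridges G| = 1%N) :
  let b : R := 2 * (n%:R - 3) * Num.sqrt 2 + Num.sqrt 10 + 2 * Num.sqrt 13 in
  b <= sombor R G /\ (sombor R G = b <-> graph_iso G (P1 n)).
Proof.
move: hn; rewrite -hV => {n hV} V3 b.
have [u [v [Guv BA dv du dx]]] := one_bridge_degrees hconn (ltnW V3) hbridge.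
have [y1 [y2 [y12 y1u y2u Gv1 Gv2]]] := other_nbrs Guv dv.
have geE := card_edges_ge Guv dv du dx.
have := sombor_bound Guv dv du dx R y12 y1u y2u Gv1 Gv2; rewrite -/b => bnd.
have s8 : 0 < Num.sqrt 8%:R :> R by rewrite sqrtr_gt0 ltr0n.
have le0 : 0 <= (#|edges G|%:R - #|V|%:R) * Num.sqrt 8%:R :> R.
  by apply: mulr_ge0 (ltW s8); rewrite subr_ge0 ler_nat.
split; first by lra.
have eqE := sombor_eq Guv dv du dx R y12 y1u y2u Gv1 Gv2.
split=> [Eb|iso].
  (* Equality leaves no room for the surplus [(#|E| - #|V|) * sqrt 8], and [sqrt 8] is positive. *)
  have EV : #|edges G| = #|V|.
    apply/eqP; rewrite eqn_leq geE andbT -(ler_nat R) -subr_le0.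
    by rewrite -(pmulr_lle0 _ s8); lra.
  have [du1 dv3 dx2] := card_edges_eq Guv dv du dx EV.
  apply: (lollipop_iso hconn Guv du1 dv3 dx2 Gv1).
  (* The only bridge is [uv], so a bridge from [v] to [y1] would give [y1 = u]. *)
  apply: contraNN y1u => b1; apply/eqP.
  have : [set v; y1] \in bridges G by rewrite inE.
  by rewrite BA => /set1P; rewrite [RHS]setUC => /set2_injr.
(* Degree sums are isomorphism invariant, so [G] has no more edges than vertices. *)
apply: eqE; apply/eqP; rewrite eqn_leq geE andbT -(leq_pmul2l (m := 2)) //.
rewrite -sum_deg (graph_iso_sum_deg iso) sum_deg_P1_le //.
exact: ltnW (ltnW V3).
Qed.
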